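(* Let $\eta$ be a local configuration of radius $r>0$ with $k(\eta)\ge 1$ positive vertices and perimeter $\gamma(\eta)$. Let $c>0$ be a constant, let $b>0$, and let the magnetic field $a=a(n)$ be defined by $e^{2a(n)}=c\,n^{-d/k(\eta)}$. Then the law $\mathcal L(X_n(\eta))$ of $X_n(\eta)$ under the Ising measure $\mu_{a(n),b}$ satisfies $$d_{TV}\big(\mathcal L(X_n(\eta)),\ \mathcal P(c^{k(\eta)}e^{-2b\gamma(\eta)})\big)=\mathcal O(n^{-d/k(\eta)}),$$ where $\mathcal P(\lambda)$ denotes the Poisson distribution with parameter $\lambda$; that is, there is a constant $C>0$ such that for all $n$ the left-hand side is at most $C\,n^{-d/k(\eta)}$.
   Context: Fix an integer $d\ge 1$, $p\in[1,\infty]$ and a real $\rho>0$. For an integer $n\ge 1$, $G_n=(V_n,E_n)$ is the graph (lattice torus) with vertex set $V_n=\{0,\dots,n-1\}^d$ (operations on vertices taken componentwise modulo $n$), where two distinct vertices $x,y$ are joined by an edge iff $\|y-x\|_p\le\rho$, the difference being taken componentwise modulo $n$ (each coordinate represented by its residue of minimal absolute value). All vertices have the same number of neighbors, denoted $\mathcal V$. Ising model: for reals $a,b$, $\mu_{a,b}$ is the probability measure on $\mathcal X_n=\{-1,+1\}^{V_n}$ with $$\mu_{a,b}(\sigma)=\frac1{Z_{a,b}}\exp\Big(a\sum_{x\in V_n}\sigma(x)+b\sum_{\{x,y\}\in E_n}\sigma(x)\sigma(y)\Big),$$ where $Z_{a,b}$ is the normalizing constant. $dist$ is the graph distance and $B(x,r)=\{y\in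 V_n: dist(x,y)\le r\}$. Only sizes $n>2\rho(r+1)$ are considered (''for all $n$'' means for all such $n$); then the balls $B(0,r)$ for different $n$, with their induced graph structure, are canonically identified. A local configuration of radius $r$ is an element $\eta\in\mathcal D_r=\{-1,+1\}^{B(0,r)}$ (fixed, not depending on $n$). Put $V_+(\eta)=\{x\in B(0,r):\eta(x)=+1\}$ and $k(\eta)=|V_+(\eta)|$. The perimeter is $$\gamma(\eta)=\mathcal V\,|V_+(\eta)|-2\,\big|\{\{x,y\}\in E_n: x,y\in V_+(\eta)\}\big|,$$ which does not depend on $n$. For $x\in V_n$, $\eta_x$ is the translate of $\eta$ to $B(x,r)$: $\eta_x(x+y)=\eta(y)$ for $y\in B(0,r)$. $I_x^\eta(\sigma)=1$ if the restriction of $\sigma\in\mathcal X_n$ to $B(x,r)$ equals $\eta_x$, and $0$ otherwise. $X_n(\eta)=\sum_{x\in V_n}I_x^\eta$. Total variation distance: $d_{TV}(\mu,\nu)=\sup_A|\mu(A)-\nu(A)|$ over measurable sets $A$. *)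

(* Defs.v *)
From HB Require Import structures.
From mathcomp Require Import all_boot all_order all_algebra.
From mathcomp Require Import all_classical all_reals all_analysis.

Set Implicit Arguments.
Unset Strict Implicit.
Unset Printing Implicit Defensive.

Import Order.TTheory GRing.Theory Num.Theory.
Import numFieldNormedType.Exports.

Local Open Scope classical_set_scope.
Local Open Scope ring_scope.

(* The l^p norm of R^d, 1 <= p <= +oo; the value at p = -oo is junk. *)
Definition lpnorm (R : realType) (d : nat) (p : \bar R) (v : 'I_d -> R) : R :=
  match p with
  | q%:E => (\sum_i `|v i| `^ q) `^ q^-1
  | +oo%E => \big[Num.max/0]_i `|v i|
  | -oo%E => 0
  end.

(* The coordinate type 'I_n.-1.+1 is 'I_n for n >= 1, in the form in which the
   library provides addition modulo n on it (including for n = 1). *)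
Definition torus (d n : nat) : Type := {ffun 'I_d -> 'I_n.-1.+1}.

HB.instance Definition _ d n := Finite.on (torus d n).
HB.instance Definition _ d n := GRing.Zmodule.on (torus d n).

(* The residue of i modulo n of minimal absolute value; n./2 is preferred to
   - n./2 when n is even. *)
Definition minres (n : nat) (i : 'I_n.-1.+1) : int :=
  if (i.*2 <= n)%N then i%:Z else i%:Z - n%:Z.

Definition reduce (n : nat) (z : int) : 'I_n.-1.+1 := inZp `|(z %% n%:Z)%Z|%N.

Section graph.
Variables (R : realType) (d : nat) (p : \bar R) (rho : R) (n : nat).
Implicit Types x y : torus d n.

Definition adj : rel (torus d n) :=
  fun x y => (x != y) && (lpnorm p (fun i => (minres ((y - x) i))%:~R) <= rho).

Definition edges : {set {set torus d n}} :=
  [set [set e.1; e.2] | e : torus d n * torus d n & adj e.1 e.2]%SET.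

(* The number of neighbours of the vertex 0, hence of any vertex. *)
Definition valency : nat := #|[set y | adj 0 y]%SET|.

Definition walk x y (k : nat) : bool :=
  [exists s : k.-tuple (torus d n), path adj x s && (last x s == y)].

(* None stands for infinity: the graph has no edges when rho < 1. *)
Definition gdist x y : option nat :=
  match pselect (exists k, walk x y k) with
  | left xy => Some (ex_minn xy)
  | right _ => None
  end.

Definition gball x (r : nat) : {set torus d n} :=
  [set y | if gdist x y is Some k then (k <= r)%N else false]%SET.

End graph.

Arguments adj {R d} p rho {n}.
Arguments edges {R} d p rho n.
Arguments valency {R} d p rho n.
Arguments walk {R d} p rho {n}.
Arguments gdist {R d} p rho {n}.
Arguments gball {R d} p rho {n}.

Definition admissible (R : realType) (rho : R) (r n : nat) : Prop :=
  2 * rho * r.+1%:R < n%:R.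

(* The identification of the balls B(0,r) of the tori of admissible sizes m
   and n: a vertex is sent to the vertex with the same small displacement. *)
Definition transport (d m n : nat) (y : torus d m) : torus d n :=
  [ffun i => reduce n (minres (y i))].
Arguments transport {d m} n y.

(* Spins are booleans: true is +1 and false is -1. *)
Definition spin (R : realType) (s : bool) : R := if s then 1 else -1.

Definition config (d n : nat) : Type := {ffun torus d n -> bool}.

HB.instance Definition _ d n := Finite.on (config d n).
HB.instance Definition _ d n := isPointed.Build (config d n) [ffun=> false].
HB.instance Definition _ d n := @isMeasurable.Build default_measure_display
  (config d n) discrete_measurable discrete_measurable0
  discrete_measurableC discrete_measurableU.

Section ising.
Variables (R : realType) (d : nat) (p : \bar R) (rho : R) (n : nat) (a b : R).

Definition ising_weight (sigma : config d n) : R :=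
  expR (a * \sum_x spin R (sigma x) +
        b * \sum_(e in edges d p rho n) \prod_(x in e) spin R (sigma x)).

Definition partition_function : R := \sum_(sigma : config d n) ising_weight sigma.

Definition ising : set (config d n) -> \bar R :=
  fun U => \esum_(sigma in U) (ising_weight sigma / partition_function)%:E.

Lemma partition_function_gt0 : 0 < partition_function.
Proof.
rewrite /partition_function (bigD1 [ffun=> false])//=.
by rewrite ltr_pwDl ?expR_gt0// sumr_ge0// => sigma _; exact: expR_ge0.
Qed.

Let ising_pmf_ge0 (sigma : config d n) :
  0 <= ising_weight sigma / partition_function.
Proof. by rewrite divr_ge0 ?expR_ge0// ltW// partition_function_gt0. Qed.

Let ising0 : ising set0 = 0%E.
Proof. exact: esum_set0. Qed.

Let ising_ge0 U : (0 <= ising U)%E.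
Proof. by apply: esum_ge0 => sigma _; rewrite lee_fin. Qed.

Let ising_sigma_additive : semi_sigma_additive ising.
Proof.
move=> F mF tF mUF; rewrite /ising.
apply: cvg_toP.
  apply: ereal_nondecreasing_is_cvgn => i j ij.
  apply: lee_sum_nneg_natr => // k _ _.
  by apply: esum_ge0 => /= ? _; rewrite lee_fin.
by rewrite nneseries_sum_bigcup// => i; rewrite lee_fin.
Qed.

HB.instance Definition _ := isMeasure.Build _ _ _ ising
  ising0 ising_ge0 ising_sigma_additive.

Let ising_setT : ising [set: _] = 1%E.
Proof.
rewrite /ising esum_fset; [|exact: finite_finset|by move=> i _; rewrite lee_fin].
rewrite (_ : [set: config d n] = [set` enum {: config d n}]); last first.
  by apply/seteqP; split=> x //= _; rewrite mem_enum.
rewrite -fsbig_seq ?enum_uniq// big_enum/= sumEFin -mulr_suml divff//.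
by rewrite gt_eqF// partition_function_gt0.
Qed.

HB.instance Definition _ := @Measure_isProbability.Build _ _ R ising ising_setT.

End ising.

Arguments ising {R d} p rho n a b.

Section local_configuration.
Variables (R : realType) (d : nat) (p : \bar R) (rho : R) (r m : nat).

(* The ball is taken in the torus of some admissible reference size m; on the
   other admissible tori the configuration is read through transport. *)
Definition local_config : Type :=
  {ffun {y : torus d m | y \in gball p rho 0 r} -> bool}.

Implicit Types eta : local_config.

Definition positives eta : {set torus d m} :=
  [set val y | y : {y : torus d m | y \in gball p rho 0 r} & eta y]%SET.

Definition perimeter eta : int :=
  (valency d p rho m)%:Z * #|positives eta|%:Z -
  2 * #|[set e in edges d p rho m | e \subset positives eta]%SET|%:Z.

(* The restriction of sigma to B(x,r) is the translate of eta. *)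
Definition occurs eta (n : nat) (x : torus d n) (sigma : config d n) : bool :=
  [forall y, sigma (x + transport n (val y)) == eta y].

Definition occurrences eta (n : nat) (sigma : config d n) : nat :=
  (\sum_(x : torus d n) occurs eta x sigma)%N.

Let measurable_occurrences eta n : measurable_fun setT (occurrences eta (n := n)).
Proof. by []. Qed.

HB.instance Definition _ eta n := @isMeasurableFun.Build _ _ _ _
  (occurrences eta (n := n)) (@measurable_occurrences eta n).

End local_configuration.

Arguments local_config {R} d p rho r m.
Arguments occurrences {R d p rho r m} eta n sigma.

(* The library's poisson_prob takes a dummy second argument. *)
Definition poisson (R : realType) (lambda : R) : probability nat R :=
  poisson_prob lambda 0%N.

Definition tv_dist (d : measure_display) (T : measurableType d) (R : realType)
    (mu nu : probability T R) : \bar R :=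
  ereal_sup [set `|mu A - nu A|%E | A in measurable].

(* Main.v *)
Require Import Defs.
From HB Require Import structures.
From mathcomp Require Import all_boot all_order all_algebra.
From mathcomp Require Import all_classical all_reals all_analysis.
From mathcomp Require Import ring lra zify.

Set Implicit Arguments.
Unset Strict Implicit.
Unset Printing Implicit Defensive.

Import Order.TTheory GRing.Theory Num.Theory.
Import numFieldNormedType.Exports.

Local Open Scope classical_set_scope.
Local Open Scope ring_scope.

(* By Stein's method it is enough to bound E[X g(X)] - lambda E[g(X+1)] for
   bounded g, where X counts the occurrences of eta.  Write k for the number of
   positive vertices, gamma for the perimeter, N = n^d and eps = e^{2a}.  Turning
   on the translate of the positive vertices to x, in a configuration which is
   all minus on a window around x of bounded size, multiplies the Ising weight by
   exactly eps^k e^{-2 b gamma} and increases X by exactly 1.  Hence the part of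
   E[1(occurrence at x) g(X)] where the window contains no further plus equals
   eps^k e^{-2 b gamma} E[g(X+1); window all minus], and N eps^k = c^k.  Turning
   on a set T multiplies the weight by at most (K eps)^|T|, so T is all plus with
   probability at most (K eps)^|T|, and the two discarded events cost
   O(eps^{k+1}) and O(eps) respectively; summing over x the error is O(eps). *)

(** * The Stein equation of the Poisson distribution *)

Lemma leq_fact_mul (m n : nat) : (m`! * n`! <= (m + n)`!)%N.
Proof.
rewrite -(@bin_fact (m + n) m) ?leq_addr// addKn leq_pmull//.
by rewrite bin_gt0 leq_addr.
Qed.

Lemma series_exp_coeff_le_expR (R : realType) (x : R) (n : nat) :
  0 <= x -> series (exp_coeff x) n <= expR x.
Proof.
move=> x0; apply: nondecreasing_cvgn_le; last exact: is_cvg_series_exp_coeff.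
by apply: nondecreasing_series => i _ _; exact: exp_coeff_ge0.
Qed.

(** Since [n! i! <= (n + i)!], the tail from index [n] on is dominated termwise by [x^n / n!] times
    the whole exponential series. *)
Lemma expR_le_series_tail (R : realType) (x : R) (n : nat) : 0 <= x ->
  expR x <= series (exp_coeff x) n + exp_coeff x n * expR x.
Proof.
move=> x0; apply: limr_le; first exact: is_cvg_series_exp_coeff.
apply: nearW => M.
have /le_trans : series (exp_coeff x) M <= series (exp_coeff x) (n + M)%N.
  apply: (@nondecreasing_series _ (exp_coeff x) xpredT 0%N) => [i _ _|].
    exact: exp_coeff_ge0.
  exact: leq_addl.
apply; rewrite /series/= (@big_cat_nat _ _ _ n)//= ?leq_addr//.
rewrite lerD2l -[X in index_iota X]add0n big_addn addKn.
apply: (@le_trans _ _ (exp_coeff x n * series (exp_coeff x) M)).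
  rewrite /series/= mulr_sumr; apply: ler_sum => i _.
  rewrite /exp_coeff/= addnC exprD mulrACA ler_wpM2l//.
    by rewrite mulr_ge0 ?exprn_ge0.
  rewrite -invfM -natrM lef_pV2 ?posrE ?ltr0n ?muln_gt0 ?fact_gt0//.
  by rewrite ler_nat leq_fact_mul.
by rewrite ler_wpM2l ?exp_coeff_ge0// series_exp_coeff_le_expR.
Qed.

Lemma poisson_setI_II (R : realType) (lambda : R) (A : set nat) (n : nat) :
  0 < lambda -> poisson lambda (A `&` `I_n) =
    (\sum_(i < n) poisson_pmf lambda i * (nat_of_ord i \in A)%:R)%:E.
Proof.
move=> l0.
have esum1 i : poisson lambda [set i] = (poisson_pmf lambda i)%:E.
  by rewrite /poisson/= /poisson_prob l0 esum_set1// lee_fin poisson_pmf_ge0.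
elim: n => [|n IH]; first by rewrite II0 setI0 measure0 big_ord0.
rewrite IIS setIUr measureU//=; last first.
  by rewrite -subset0 => i [[_ /= i_n] [_ /= in_]]; rewrite in_ ltnn in i_n.
rewrite IH big_ord_recr/= EFinD; congr (_ + _)%E.
have [nA|nA] := boolP (n \in A).
  rewrite mulr1 (_ : A `&` [set n] = [set n]) ?esum1//.
  by apply/seteqP; split=> [i []//|i /= ->]; split=> //; rewrite inE in nA.
rewrite mulr0 (_ : A `&` [set n] = set0) ?measure0// -subset0 => i [Ai /= i_n].
by rewrite i_n in Ai; rewrite notin_setE in nA.
Qed.

(* Bounding g through the tail of the Poisson distribution, rather than through
   its head, gives a bound which is uniform in the argument. *)
Lemma poisson_stein (R : realType) (lambda : R) (A : set nat) : 0 < lambda ->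
  exists2 g : nat -> R, (forall j, `|g j| <= expR lambda) &
    forall j, lambda * g j.+1 - j%:R * g j =
      (j \in A)%:R - fine (poisson lambda A).
Proof.
move=> l0; pose P : probability nat R := poisson lambda.
pose w := poisson_pmf lambda.
have wE j : w j = lambda ^+ j * j`!%:R^-1 * expR (- lambda).
  by rewrite /w /poisson_pmf l0.
have w0 j : 0 < w j.
  by rewrite wE !mulr_gt0 ?exprn_gt0 ?invr_gt0 ?ltr0n ?fact_gt0 ?expR_gt0.
have wS j : lambda * w j = w j.+1 * j.+1%:R.
  rewrite !wE factS natrM invfM exprS.
  have f0 : j`!%:R != 0 :> R by rewrite pnatr_eq0 -lt0n fact_gt0.
  by field; rewrite f0 addrC natr1 pnatr_eq0.
pose S n := \sum_(i < n) w i * ((nat_of_ord i \in A)%:R - fine (P A)).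
(* By [wS], both terms of the equation at [j] get the denominator [w j], and their difference is the
   last increment of [S]. The value at 0 enters the equation with the factor [j = 0]. *)
exists (fun j => if j is i.+1 then S i.+1 / (lambda * w i) else 0); last first.
  have SS j : S j.+1 = S j + w j * ((j \in A)%:R - fine (P A)).
    by rewrite /S big_ord_recr.
  case=> [|j].
    rewrite SS /S big_ord0 add0r mul0r subr0; have := w0 0%N.
    by move=> w00; field; rewrite !gt_eqF.
  rewrite (SS j.+1) (wS j); have wj := w0 j.+1.
  by field; rewrite !gt_eqF//= addrC natr1 ltr0n.
case=> [|j]; first by rewrite normr0 ltW ?expR_gt0.
set s := \sum_(i < j.+1) w i.
have sE : P `I_j.+1 = s%:E.
  rewrite -[`I_j.+1]setTI poisson_setI_II//; congr _%:E.
  by apply: eq_bigr => i _; rewrite mem_set// mulr1.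
pose u := \sum_(i < j.+1) w i * (nat_of_ord i \in A)%:R.
have uE : P (A `&` `I_j.+1) = u%:E by rewrite poisson_setI_II.
pose v := fine (P (A `\` `I_j.+1)).
have vE : P (A `\` `I_j.+1) = v%:E by rewrite fineK// fin_num_measure.
have PAE : fine (P A) = u + v.
  have -> // : P A = (u + v)%:E.
  by rewrite addrC EFinD -vE -uE; exact: measureDI.
have u0 : 0 <= u by rewrite -lee_fin -uE.
have us : u <= s by rewrite -lee_fin -uE -sE le_measure ?inE//; exact: subIsetr.
have v0 : 0 <= v by rewrite -lee_fin -vE.
have vs : v <= 1 - s.
  rewrite lerBrDr -lee_fin EFinD -vE -sE -measureU//; last first.
    by rewrite -subset0 => i [[_]].
  exact: probability_le1.
(* Here [u] and [v] are the masses of [A] below [j.+1] and from [j.+1] on; [u <= s] and [v <= 1 - s]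
   bound each product by the tail mass [1 - s]. *)
have SE : S j.+1 = u * (1 - s) - s * v.
  rewrite /S; under eq_bigr do rewrite mulrBr.
  by rewrite big_split/= sumrN -mulr_suml PAE -/u -/s; ring.
have s1 : 1 - s <= exp_coeff lambda j.+1.
  have -> : s = expR (- lambda) * series (exp_coeff lambda) j.+1.
    rewrite /s /series/= big_mkord mulr_sumr; apply: eq_bigr => i _.
    by rewrite wE mulrC.
  have := expR_le_series_tail j.+1 (ltW l0).
  rewrite -(ler_pM2l (expR_gt0 (- lambda))) expRN mulVf ?gt_eqF ?expR_gt0//.
  rewrite mulrDr mulrCA mulVf ?gt_eqF ?expR_gt0// mulr1; lra.
rewrite normrM normfV (gtr0_norm (mulr_gt0 l0 (w0 j))) ler_pdivrMr ?mulr_gt0//.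
have S1 : `|S j.+1| <= 1 - s.
  have s0 : 0 <= 1 - s by exact: le_trans vs.
  by rewrite SE ler_norml; apply/andP; split; nra.
apply: (le_trans S1); apply: (le_trans s1).
(* The factor [expR lambda] cancels the normalisation of [w j]; what remains is the comparison of
   [(j + 1)!] with [j!]. *)
have -> : expR lambda * (lambda * w j) = lambda ^+ j.+1 / j`!%:R.
  have f0 : j`!%:R != 0 :> R by rewrite pnatr_eq0 -lt0n fact_gt0.
  by rewrite wE exprS expRN; field; rewrite f0 gt_eqF ?expR_gt0.
rewrite /exp_coeff/= ler_wpM2l ?exprn_ge0 ?(ltW l0)//.
by rewrite lef_pV2 ?posrE ?ltr0n ?fact_gt0// ler_nat factS leq_pmull.
Qed.

(** * Geometry of the torus *)

Section residues.
Variable n : nat.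
Hypothesis n0 : (0 < n)%N.
Implicit Types (z t : int) (i j : 'I_n.-1.+1).

Let ltn_res i : (i < n)%N.
Proof. by have := ltn_ord i; move: (i : nat) => k; rewrite prednK. Qed.

Lemma reduceE z : (reduce n z : nat)%:Z = (z %% n%:Z)%Z.
Proof.
have nN0 : n%:Z != 0 by rewrite eqz_nat -lt0n.
rewrite /reduce /= prednK// modn_small ?gez0_abs ?modz_ge0//.
by rewrite -ltz_nat gez0_abs ?modz_ge0// ltz_pmod// ltz_nat.
Qed.

Lemma reduceD z t : reduce n (z + t) = reduce n z + reduce n t.
Proof.
apply: val_inj; apply/eqP; rewrite -eqz_nat; apply/eqP.
have nN0 : n%:Z != 0 by rewrite eqz_nat -lt0n.
rewrite reduceE /= -modz_nat prednK// PoszD -!modz_nat.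
by rewrite !gez0_abs ?modz_ge0// !modz_mod modzDml modzDmr.
Qed.

Lemma reduceN z : reduce n (- z) = - reduce n z.
Proof.
apply/eqP; rewrite -addr_eq0 -reduceD addNr; apply/eqP/val_inj.
by rewrite /= mod0z mod0n.
Qed.

Lemma minres_mod i : (minres i = i %[mod n%:Z])%Z.
Proof.
by rewrite /minres; case: ifP => // _; rewrite -[RHS](modzMDl (-1)) mulN1r addrC.
Qed.

Lemma minresK i : reduce n (minres i) = i.
Proof.
apply: val_inj; apply/eqP; rewrite -eqz_nat; apply/eqP.
by rewrite reduceE minres_mod modz_small// ltz_nat lez_nat/= ltn_res.
Qed.

Lemma minres_bound i : `|minres i| * 2 <= n%:Z.
Proof.
by have := ltn_res i; rewrite /minres; case: ifP => i2; lia.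
Qed.

(** Both sides are congruent modulo [n] and differ by less than [n]. Strictness excludes the tie
    [- n / 2], which would come back as [n / 2]. *)
Lemma reduceK z : `|z| * 2 < n%:Z -> minres (reduce n z) = z.
Proof.
move=> zn.
have := minres_bound (reduce n z).
have : (minres (reduce n z) = z %[mod n%:Z])%Z.
  by rewrite minres_mod reduceE modz_mod.
move=> /eqP; rewrite eqz_mod_dvd => /dvdzP[q].
have [q0|q0|->] := ltgtP q 0; last lia.
  by have : q * n%:Z <= - n%:Z; [rewrite -mulN1r ler_wpM2r//; lia|lia].
by have : n%:Z <= q * n%:Z; [rewrite -{1}[n%:Z]mul1r ler_wpM2r//; lia|lia].
Qed.

Lemma minres_reduce z : exists q : int, minres (reduce n z) = z + q * n%:Z.
Proof.
have /eqP : (minres (reduce n z) = z %[mod n%:Z])%Z.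
  by rewrite minres_mod reduceE modz_mod.
rewrite eqz_mod_dvd => /dvdzP[q e]; exists q; lia.
Qed.

(** Distinct representatives of a class differ by at least [n], and [minres] has size at most
    [n / 2]. This yields triangle inequalities for wrapped coordinates. *)
Lemma minres_min z : `|minres (reduce n z)| <= `|z|.
Proof.
have := minres_bound (reduce n z); have [q ->] := minres_reduce z.
have [q0|q0|->] := ltgtP q 0; last lia.
  by have : q * n%:Z <= - n%:Z; [rewrite -mulN1r ler_wpM2r//; lia|lia].
by have : n%:Z <= q * n%:Z; [rewrite -{1}[n%:Z]mul1r ler_wpM2r//; lia|lia].
Qed.

(** Only the sizes agree: for even [n] the residue [n / 2] is its own opposite. *)
Lemma minresN i : `|minres (- i)| = `|minres i|.
Proof.
apply/eqP; rewrite eq_le; apply/andP; split.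
  by rewrite -{1}(minresK i) -reduceN (le_trans (minres_min _))// normrN.
by rewrite -{1}(opprK i) -{1}(minresK (- i)) -reduceN (le_trans (minres_min _))// normrN.
Qed.

Lemma minresB i j : i - j = reduce n (minres i - minres j).
Proof. by rewrite reduceD reduceN !minresK. Qed.

Lemma minresD i j : i + j = reduce n (minres i + minres j).
Proof. by rewrite reduceD !minresK. Qed.

End residues.

Section lpnorm.
Variables (R : realType) (d : nat) (p : \bar R).
Implicit Types v w : 'I_d -> R.

Lemma eq_lpnorm v w : (forall i, `|v i| = `|w i|) -> lpnorm p v = lpnorm p w.
Proof.
rewrite /lpnorm => vw; case: p => [q| |]; last reflexivity.
  by congr (_ `^ _); apply: eq_bigr => i _; rewrite vw.
by apply: eq_bigr => i _; rewrite vw.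
Qed.

Lemma le_lpnorm v i : (1 <= p)%E -> `|v i| <= lpnorm p v.
Proof.
rewrite /lpnorm; case: p => [q| |] //; last by move=> _; exact: le_bigmax.
rewrite lee_fin => q1; have q0 : 0 < q by exact: lt_le_trans q1.
rewrite -{1}(powRr1 (normr_ge0 (v i))) -(@mulfV _ q) ?gt_eqF// powRrM.
apply: ge0_ler_powR; rewrite ?nnegrE ?invr_ge0 ?powR_ge0 ?(ltW q0)//.
  by rewrite sumr_ge0// => j _; exact: powR_ge0.
by rewrite (bigD1 i)//= lerDl sumr_ge0// => j _; exact: powR_ge0.
Qed.

End lpnorm.

Section torus_graph.
Variables (R : realType) (d : nat) (p : \bar R) (rho : R).
Hypothesis p1 : (1 <= p)%E.

Definition tnorm n (z : torus d n) : R :=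
  lpnorm p (fun i => (minres (z i))%:~R).

Lemma tnormN n (z : torus d n) : (0 < n)%N -> tnorm (- z) = tnorm z.
Proof.
move=> n0; apply: eq_lpnorm => i.
by rewrite !ffunE -!intr_norm minresN.
Qed.

Lemma le_tnorm n (z : torus d n) i : `|minres (z i)|%:~R <= tnorm z.
Proof. by rewrite intr_norm (le_lpnorm (fun i => (minres (z i))%:~R)). Qed.

(** Adjacency depends on [y - x] alone, so the torus is a Cayley graph and translations are
    automorphisms. *)
Lemma adjE n (x y : torus d n) :
  adj p rho x y = (y - x != 0) && (tnorm (y - x) <= rho).
Proof. by rewrite /adj /tnorm subr_eq0 eq_sym. Qed.

Lemma adjDl n (z x y : torus d n) : adj p rho (z + x) (z + y) = adj p rho x y.
Proof. by rewrite !adjE opprD addrACA subrr add0r. Qed.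

Lemma adjC n (x y : torus d n) : (0 < n)%N -> adj p rho x y = adj p rho y x.
Proof. by move=> n0; rewrite !adjE -(opprB x y) tnormN// oppr_eq0. Qed.

Lemma adj_minres_le n (x y : torus d n) i : (0 < n)%N -> adj p rho x y ->
  `|minres (y i)|%:~R <= `|minres (x i)|%:~R + rho.
Proof.
move=> n0; rewrite adjE => /andP[_ xy].
apply: (@le_trans _ _ (`|minres (x i)|%:~R + `|minres ((y - x) i)|%:~R)); last first.
  by rewrite lerD2l (le_trans _ xy)// le_tnorm.
rewrite -intrD ler_int -{1}(subrK x y) addrC ffunE minresD//.
by rewrite (le_trans (minres_min _ _))// ler_normD.
Qed.

(** Each step of a walk increases the size of a coordinate by at most [rho]; hence balls of radius
    [r] do not wrap around an admissible torus. *)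
Lemma gball_minres_le n r (y : torus d n) i : (0 < n)%N -> 0 < rho ->
  y \in gball p rho 0 r -> `|minres (y i)|%:~R <= rho * r%:R.
Proof.
move=> n0 rho0; rewrite inE /gdist; case: pselect => // ex.
case: ex_minnP => k /existsP[s /andP[ps /eqP <-]] _ kr.
apply: (@le_trans _ _ (rho * k%:R)); last by rewrite ler_pM2l// ler_nat.
(* The coordinate of the starting vertex is inserted so that the induction along the walk can vary
   that vertex. *)
have -> : rho * k%:R = `|minres ((0 : torus d n) i)|%:~R + rho * (size s)%:R.
  by rewrite ffunE /minres/= add0r size_tuple.
elim: (tval s) (0 : torus d n) ps => [|z t IH] x /=.
  by rewrite mulr0 addr0.
move=> /andP[xz /IH/le_trans]; apply.
have := adj_minres_le i n0 xz; rewrite -natr1 mulrDr mulr1; lra.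
Qed.

End torus_graph.

(** * Comparison of the reference torus with larger tori *)

Section transport.
Variables d m n : nat.
Hypothesis m0 : (0 < m)%N.
(** Residues modulo [m] have size at most [m / 2], their differences at most [m], and a difference
    plus a residue at most [3 m / 2]. All stay strictly below [n / 2], so none wraps around. *)
Hypothesis mn : (4 * m <= n)%N.

Let n0 : (0 < n)%N. Proof. by rewrite (leq_trans _ mn)// muln_gt0. Qed.

Lemma minres_transport (y : torus d m) i :
  minres (transport n y i) = minres (y i).
Proof. by rewrite ffunE reduceK//; have := minres_bound m0 (y i); lia. Qed.

Lemma transport_inj : injective (@transport d m n).
Proof.
move=> x y xy; apply/ffunP => i.
by rewrite -(minresK m0 (x i)) -(minresK m0 (y i)) -!minres_transport xy.
Qed.

Lemma transport0 : transport n (0 : torus d m) = 0.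
Proof.
apply/ffunP => i; rewrite -(minresK n0 (_ i)) minres_transport !ffunE.
by apply: val_inj; rewrite /= /minres/= mod0z mod0n.
Qed.

(** A set winding around the torus may be invariant under a nonzero translation; a set confined to a
    small box may not. Hence the plus set of an occurrence determines its position. *)
Lemma stable_shift0 (P : {set torus d n}) (z : torus d n) : P != finset.set0 ->
  (forall u i, u \in P -> `|minres (u i)| * 2 <= m%:Z) ->
  (forall u, u \in P -> z + u \in P) -> z = 0.
Proof.
move=> /set0Pn[u0 Pu0] Pm Pz; apply/ffunP => i; rewrite ffunE.
have zm : `|minres (z i)| <= m%:Z.
  have -> : z i = (z + u0) i - u0 i by rewrite !ffunE addrK.
  rewrite minresB//; apply: (le_trans (minres_min n0 _)).
  by have := Pm _ i Pu0; have := Pm _ i (Pz _ Pu0); lia.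
have zD u : u \in P -> minres ((z + u) i) = minres (z i) + minres (u i).
  move=> Pu; rewrite ffunE/= minresD// reduceK//.
  by have := Pm _ i Pu; lia.
have zP : [set z + u | u in P]%SET = P.
  apply/eqP; rewrite eqEcard card_imset ?leqnn ?andbT; last exact: addrI.
  by apply/fintype.subsetP => _ /imsetP[u Pu ->]; exact: Pz.
(* A shift by z permutes P but adds minres (z i) to each i-th coordinate. *)
have : \sum_(u in P) minres (u i) = \sum_(u in P) (minres (z i) + minres (u i)).
  rewrite -{1}zP big_imset/=; last by move=> ? ? _ _; exact: addrI.
  by apply: eq_bigr => u /zD.
rewrite big_split/= sumr_const => /eqP.
rewrite -subr_eq0 opprD addrCA subrr addr0 oppr_eq0 mulrn_eq0 => /orP[|/eqP z0].
  by rewrite cards_eq0 => /eqP P0; rewrite P0 inE in Pu0.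
rewrite -(minresK n0 (z i)) z0.
by apply: val_inj; rewrite /= mod0z mod0n.
Qed.

Section transport_graph.
Variables (R : realType) (p : \bar R) (rho : R).
Hypothesis p1 : (1 <= p)%E.

Lemma tnorm_transport (y : torus d m) : tnorm p (transport n y) = tnorm p y.
Proof. by apply: eq_lpnorm => i; rewrite minres_transport. Qed.

Lemma valency_transport : 2 * rho < m%:R -> valency d p rho n = valency d p rho m.
Proof.
move=> rhom; rewrite /valency -(card_imset _ transport_inj).
congr #|pred_of_set _|; apply/setP => y; rewrite inE; apply/idP/imsetP => [|[x]].
  rewrite adjE subr0 => /andP[y0 yrho].
  (* The preimage of a neighbour of 0 is its transport back: its residues have size at most
     [rho < m / 2] and survive the round trip. *)
  have yE : transport n (transport m y) = y.
    apply/ffunP => i; rewrite -[RHS](minresK n0) -[LHS](minresK n0) minres_transport.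
    rewrite ffunE reduceK//.
    have := le_trans (le_tnorm p1 y i) yrho.
    by rewrite -(ltr_int R) intrM -[_%:Z%:~R]/m%:R => yi; lra.
  exists (transport m y); last by [].
  rewrite inE adjE subr0 -tnorm_transport yE yrho andbT.
  by apply: contraNneq y0 => y0; rewrite -yE y0 transport0.
rewrite inE !adjE !subr0 => /andP[x0 xrho] ->; rewrite tnorm_transport xrho andbT.
by rewrite -transport0 (inj_eq transport_inj).
Qed.

(* If the displacement dl is at least m / 2 in some coordinate, it exceeds rho on
   both tori: on the small one the wrapped value is at least m - 2 rho r > rho. *)
Lemma adj_transport r (u v : torus d m) : 0 < rho -> admissible rho r m ->
  u \in gball p rho 0 r -> v \in gball p rho 0 r ->
  adj p rho (transport n u) (transport n v) = adj p rho u v.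
Proof.
move=> rho0 adm u_r v_r; rewrite !adjE !subr_eq0 (inj_eq transport_inj).
have [//|uv /=] := eqVneq v u.
pose dl i : int := minres (v i) - minres (u i).
have dlm i : `|dl i| <= m%:Z.
  by have := minres_bound m0 (u i); have := minres_bound m0 (v i); rewrite /dl; lia.
have dlr i : `|dl i|%:~R <= 2 * rho * r%:R.
  have := gball_minres_le p1 i m0 rho0 u_r.
  have := gball_minres_le p1 i m0 rho0 v_r.
  have : `|dl i|%:~R <= `|minres (v i)|%:~R + `|minres (u i)|%:~R :> R.
    by rewrite -intrD ler_int ler_normB.
  lra.
have minresn i : minres ((transport n v - transport n u) i) = dl i.
  have -> : (transport n v - transport n u) i = reduce n (dl i).
    by rewrite ffunE [X in _ + X]ffunE minresB// !minres_transport.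
  by rewrite reduceK//; have := dlm i; lia.
have dlE i : (v - u) i = reduce m (dl i) by rewrite !ffunE minresB.
have [small|/existsNP[i /negP]] := pselect (forall i, `|dl i| * 2 < m%:Z).
  congr (_ <= _); apply: eq_lpnorm => i.
  by rewrite minresn dlE reduceK.
rewrite -leNgt => big.
have admr : 2 * rho * r%:R + 2 * rho < m%:R.
  by move: adm; rewrite /admissible -[r.+1%:R]natr1 mulrDr mulr1.
have rhor : 0 <= rho * r%:R by rewrite mulr_ge0// ltW.
have bigR : m%:R <= `|dl i|%:~R * 2 :> R.
  by move: big; rewrite -(ler_int R) intrM.
rewrite !leNgt; congr negb; transitivity true; last apply/esym.
  apply: (@lt_le_trans _ _ `|dl i|%:~R); first lra.
  by rewrite -minresn le_tnorm.
apply: (@lt_le_trans _ _ `|minres ((v - u) i)|%:~R); last exact: le_tnorm.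
have [q] := minres_reduce m0 (dl i); rewrite -dlE => ->.
have [->|q0] := eqVneq q 0; first by rewrite mul0r addr0; lra.
have : (m%:Z - `|dl i| <= `|dl i + q * m%:Z|).
  have : m%:Z <= `|q * m%:Z| by rewrite normrM ler_peMl//; lia.
  lia.
rewrite -(ler_int R) intrD mulrNz -[m%:Z%:~R]/m%:R.
have := dlr i; lra.
Qed.

End transport_graph.

End transport.

(** * Ising weights *)

Lemma card_setI_sum (T : finType) (A B : {set T}) :
  #|A :&: B| = (\sum_(x in A) (x \in B))%N.
Proof.
rewrite -sum1_card big_mkcond [RHS]big_mkcond/=.
by apply: eq_bigr => x _; rewrite inE; case: (x \in A) (x \in B) => [] [].
Qed.

Section edges.
Variables (R : realType) (d : nat) (p : \bar R) (rho : R) (n : nat).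
Hypothesis n0 : (0 < n)%N.
Local Notation V := (torus d n).
Local Notation E := (edges d p rho n).
Implicit Types (T : {set V}) (x y : V).

Lemma edgesP (e : {set V}) :
  reflect (exists x y, adj p rho x y /\ e = [set x; y]%SET) (e \in E).
Proof.
apply: (iffP imsetP) => [[[x y]]|[x [y [xy ->]]]].
  by rewrite inE /= => xy ->; exists x, y.
by exists (x, y); rewrite ?inE.
Qed.

Lemma degree x : #|[set e in E | x \in e]%SET| = valency d p rho n.
Proof.
have -> : [set e in E | x \in e]%SET = [set [set x; y]%SET | y in [set y | adj p rho x y]%SET]%SET.
  apply/setP => e; rewrite inE; apply/andP/imsetP => [[/edgesP[y [z [yz ->]]]]|].
    rewrite !inE => /orP[/eqP->|/eqP->]; first by exists z; rewrite ?inE.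
    by exists y; [rewrite inE adjC|rewrite finset.setUC].
  by move=> [y]; rewrite inE => xy ->; split; [apply/edgesP; exists x, y|rewrite !inE eqxx].
rewrite card_in_imset => [|y z]; last first.
  rewrite !inE => /andP[xy _] _ /setP/(_ y); rewrite !inE eqxx orbT.
  by rewrite eq_sym (negbTE xy)/= => /esym/eqP.
rewrite /valency -[RHS](card_imset _ (addrI x)); congr #|pred_of_set _|.
apply/setP => y; rewrite [LHS]inE; apply/idP/imsetP => [xy|[z]].
  have yE : y = x + (y - x) by rewrite addrC subrK.
  by exists (y - x); rewrite // inE -(adjDl _ _ x) addr0 -yE.
by rewrite inE => xz ->; rewrite -{1}[x]addr0 adjDl.
Qed.

(** Double counting of the incidences between edges and vertices of [T]. *)
Lemma sum_card_edgesI T :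
  (\sum_(e in E) #|e :&: T|%SET = valency d p rho n * #|T|)%N.
Proof.
transitivity (\sum_(e in E) \sum_(x in T) (x \in e : nat))%N.
  by apply: eq_bigr => e _; rewrite finset.setIC card_setI_sum.
rewrite exchange_big/= mulnC -sum_nat_const; apply: eq_bigr => x _.
rewrite -(degree x) -sum1_card [LHS]big_mkcond [RHS]big_mkcond/=.
by apply: eq_bigr => e _; rewrite inE; case: (e \in E) (x \in e) => [] [].
Qed.

End edges.

Section spins.
Variables (R : realType) (d : nat) (p : \bar R) (rho : R) (n : nat).
Hypothesis n0 : (0 < n)%N.
Local Notation V := (torus d n).
Local Notation E := (edges d p rho n).
Implicit Types (T : {set V}) (s : config d n).

Definition switch_on T s : config d n := [ffun z => (z \in T) || s z].
Definition switch_off T s : config d n := [ffun z => (z \notin T) && s z].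
Definition all_on T s := [forall x in T, s x].
Definition all_off T s := [forall x in T, ~~ s x].

Lemma switch_onK T s : all_off T s -> switch_off T (switch_on T s) = s.
Proof.
move=> /forall_inP Ts; apply/ffunP => z; rewrite !ffunE.
by have [/Ts/negbTE->|] := boolP (z \in T).
Qed.

Lemma switch_offK T s : all_on T s -> switch_on T (switch_off T s) = s.
Proof.
move=> /forall_inP Ts; apply/ffunP => z; rewrite !ffunE.
by have [/Ts->|] := boolP (z \in T).
Qed.

Lemma all_on_switch_on T s : all_on T (switch_on T s).
Proof. by apply/forall_inP => z zT; rewrite ffunE zT. Qed.

Lemma all_off_switch_off T s : all_off T (switch_off T s).
Proof. by apply/forall_inP => z zT; rewrite ffunE zT. Qed.

(** Switching [T] on and off are inverse bijections between the configurations all minus and all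
    plus on [T]. *)
Lemma sum_all_on T (Q : pred (config d n)) (F : config d n -> R) :
  \sum_(s | all_on T s && Q (switch_off T s)) F s =
  \sum_(s | all_off T s && Q s) F (switch_on T s).
Proof.
rewrite (reindex_onto (switch_on T) (switch_off T)) => [|s /andP[Ts _]]; last first.
  exact: switch_offK.
apply: eq_bigl => s; rewrite all_on_switch_on/=.
have [Ts|Ts] := boolP (all_off T s); first by rewrite switch_onK// eqxx andbT.
apply/negbTE; apply: contra Ts => /andP[_ /eqP <-]; exact: all_off_switch_off.
Qed.

Local Notation prod_spin e s := (\prod_(x in e) spin R (s x)).

Lemma prod_spin_pair (x y : V) s : x != y ->
  prod_spin [set x; y]%SET s = spin R (s x) * spin R (s y).
Proof. by move=> xy; rewrite big_setU1 ?inE//= big_set1. Qed.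

(** An edge missing [T] is unchanged, and any other changes by at most 2 because products of spins
    lie in [-1, 1]. *)
Lemma prod_spin_switch_on_le T s (e : {set V}) :
  prod_spin e (switch_on T s) - prod_spin e s <= 2 * #|e :&: T|%:R.
Proof.
have [eT0|eT0] := eqVneq (e :&: T)%SET finset.set0.
  rewrite eT0 cards0 mulr0 subr_le0 le_eqVlt; apply/orP; left; apply/eqP.
  apply: eq_bigr => x xe; rewrite ffunE; case: (boolP (x \in T)) => // xT.
  by move/setP: eT0 => /(_ x); rewrite !inE xe xT.
have le1 t : `|prod_spin e t| <= 1.
  rewrite normr_prod big1// => x _.
  by rewrite /spin; case: ifP; rewrite ?normrN normr1.
have := le1 s; have := le1 (switch_on T s); rewrite !ler_norml.
have : 1 <= #|e :&: T|%:R :> R by rewrite ler1n card_gt0.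
by move=> h1 /andP[h2 h3] /andP[h4 h5]; lra.
Qed.

(** The bracket is the indicator of a boundary edge of [T], whose product drops from 1 to -1; an
    inner edge has both spins flipped. Summed over edges, it gives the perimeter of [T]. *)
Lemma prod_spin_switch_on T s (e : {set V}) : e \in E ->
  all_off T s -> (forall x y, x \in T -> adj p rho x y -> ~~ s y) ->
  prod_spin e (switch_on T s) - prod_spin e s =
  - 2 * (#|e :&: T|%:R - 2 * (e \subset T)%:R).
Proof.
move=> /edgesP[x [y [xy ->]]] /forall_inP Ts adjTs.
have xNy : x != y by case/andP: xy.
have -> : (#|[set x; y] :&: T|%SET = (x \in T) + (y \in T))%N.
  by rewrite card_setI_sum big_setU1 ?inE//= big_set1.
rewrite finset.subUset !finset.sub1set !prod_spin_pair// !ffunE.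
have [xT|xT] := boolP (x \in T); have [yT|yT] := boolP (y \in T) => /=.
- rewrite (negbTE (Ts _ xT)) (negbTE (Ts _ yT)) /spin; lra.
- rewrite (negbTE (Ts _ xT)) (negbTE (adjTs _ _ xT xy)) /spin; lra.
- rewrite adjC// in xy.
  rewrite (negbTE (Ts _ yT)) (negbTE (adjTs _ _ yT xy)) /spin; lra.
- lra.
Qed.

Variables a b : R.
Local Notation w := (@ising_weight R d p rho n a b).
Local Notation v := (valency d p rho n).
Definition inner_edges T := #|[set e in E | e \subset T]%SET|.

Lemma sum_spin_switch_on T s : all_off T s ->
  \sum_x spin R (switch_on T s x) = \sum_x spin R (s x) + 2 * #|T|%:R.
Proof.
move=> /forall_inP Ts; apply/eqP; rewrite addrC -subr_eq -sumrB; apply/eqP.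
rewrite mulrC mulr_natl -sumr_const [RHS]big_mkcond/=.
apply: eq_bigr => x _; rewrite ffunE.
have [xT|xT] := boolP (x \in T); last by rewrite subrr.
rewrite (negbTE (Ts _ xT)) /spin/=; lra.
Qed.

Lemma weight_switch_on T s : all_off T s ->
  w (switch_on T s) = w s * expR (2 * a * #|T|%:R + b *
    \sum_(e in E) (prod_spin e (switch_on T s) - prod_spin e s)).
Proof.
move=> Ts; rewrite /ising_weight -expRD sum_spin_switch_on// sumrB.
by congr expR; ring.
Qed.

Lemma weight_switch_on_le T s : 0 <= b -> all_off T s ->
  w (switch_on T s) <= w s * expR (2 * a + 2 * b * v%:R) ^+ #|T|.
Proof.
move=> b0 Ts; rewrite weight_switch_on// ler_wpM2l ?expR_ge0//.
rewrite -expRM_natl ler_expR.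
have : \sum_(e in E) (prod_spin e (switch_on T s) - prod_spin e s) <=
    2 * v%:R * #|T|%:R.
  apply: (@le_trans _ _ (\sum_(e in E) 2 * #|e :&: T|%:R)).
    by apply: ler_sum => e _; exact: prod_spin_switch_on_le.
  by rewrite -mulr_sumr -natr_sum sum_card_edgesI// natrM mulrA.
move=> /(ler_wpM2l b0); lra.
Qed.

Lemma weight_switch_on_isolated T s : all_off T s ->
  (forall x y, x \in T -> adj p rho x y -> ~~ s y) ->
  w (switch_on T s) = w s * (expR (2 * a) ^+ #|T| *
    expR (- 2 * b * (v%:R * #|T|%:R - 2 * (inner_edges T)%:R))).
Proof.
move=> Ts adjTs; rewrite weight_switch_on//; congr *%R.
rewrite -expRM_natl -expRD; congr expR.
under eq_bigr => e eE do rewrite (prod_spin_switch_on eE Ts adjTs).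
rewrite -mulr_sumr sumrB -mulr_sumr -!natr_sum sum_card_edgesI// natrM.
have -> : (\sum_(e in E) (e \subset T) = inner_edges T)%N.
  rewrite /inner_edges -sum1_card big_mkcond [RHS]big_mkcond/=.
  by apply: eq_bigr => e _; rewrite inE; case: (e \in E) (e \subset T) => [] [].
ring.
Qed.

Local Notation Z := (@partition_function R d p rho n a b).

(** Each configuration all plus on [T] is charged to the one with [T] switched off, at a bounded
    cost per vertex. Divided by [Z], this bounds a probability. *)
Lemma sum_weight_all_on_le T : 0 <= b ->
  \sum_(s | all_on T s) w s <= expR (2 * a + 2 * b * v%:R) ^+ #|T| * Z.
Proof.
move=> b0; rewrite (eq_bigl (fun s => all_on T s && predT (switch_off T s))); last first.
  by move=> s; rewrite andbT.
rewrite sum_all_on.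
apply: (@le_trans _ _ (\sum_(s | all_off T s && predT s) w s * expR (2 * a + 2 * b * v%:R) ^+ #|T|)).
  by apply: ler_sum => s; rewrite andbT; exact: weight_switch_on_le.
rewrite -mulr_suml mulrC ler_wpM2l ?exprn_ge0 ?expR_ge0//.
rewrite big_mkcond/=; apply: ler_sum => s _.
by case: ifP => // _; exact: expR_ge0.
Qed.

End spins.

(** * Occurrences of a pattern *)

Lemma ler_sum_union (R : realType) (S I : finType) (w : S -> R) (A : {set I})
    (B : pred S) (Q : I -> pred S) : (forall s, 0 <= w s) ->
  (forall s, B s -> exists2 i, i \in A & Q i s) ->
  \sum_(s | B s) w s <= \sum_(i in A) \sum_(s | Q i s) w s.
Proof.
move=> w0 BQ; under [leRHS]eq_bigr do rewrite big_mkcond/=.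
rewrite exchange_big/= big_mkcond/=; apply: ler_sum => s _.
have ge0 i : 0 <= (if Q i s then w s else 0) by case: ifP.
case: ifP => [/BQ[i iA Qi]|_]; last exact: sumr_ge0.
by rewrite (bigD1 i)//= Qi lerDl sumr_ge0.
Qed.

Section pattern.
Variables (d n : nat).
Local Notation V := (torus d n).
Variables D P W : {set V}.
Hypotheses (PD : P \subset D) (P0 : P != finset.set0).
(** If [x + u = y + v], then [y + t = x + (u - v + t)]: every translate of [D] meeting [x + P] lies
    in the window [x + W]. *)
Hypothesis DW : forall u v y, u \in P -> v \in D -> y \in D -> u - v + y \in W.
Hypothesis shiftP : forall z, (forall u, u \in P -> z + u \in P) -> z = 0.
Implicit Types (x : V) (s : config d n) (A B : {set V}).

Definition shift x A : {set V} := [set x + u | u in A]%SET.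

(** Three instances matter: [seen D P] is an occurrence, [seen W P] an isolated one, and [seen W]
    with the empty set an all-minus window. *)
Definition seen A B x s := [forall u in A, s (x + u) == (u \in B)].

Definition count_seen A B s := (\sum_x seen A B x s)%N.

Lemma mem_shift x A u : (x + u \in shift x A) = (u \in A).
Proof. by rewrite /shift mem_imset//; exact: addrI. Qed.

Let subDW : D \subset W.
Proof.
have /set0Pn[u uP] := P0; apply/fintype.subsetP => y yD.
have uD : u \in D by exact: (fintype.subsetP PD).
by rewrite -(add0r y) -(subrr u) DW.
Qed.

Lemma seen_off_window x s : seen W finset.set0 x s ->
  forall u, u \in W -> s (x + u) = false.
Proof. by move=> /forall_inP xW u /xW /eqP ->; rewrite finset.in_set0. Qed.

Lemma count_switch_on x s : seen W finset.set0 x s ->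
  count_seen D P (switch_on (shift x P) s) = (count_seen D P s).+1.
Proof.
move=> /seen_off_window sW; have /set0Pn[u0 u0P] := P0.
have u0D : u0 \in D by exact: (fintype.subsetP PD).
(* The successor is written as a sum of indicators of [y == x], so that the two counts can be
   compared position by position. *)
have <- : (count_seen D P s + \sum_y (y == x) = (count_seen D P s).+1)%N.
  by rewrite (bigD1 x)//= eqxx big1 ?addn1// => y /negbTE ->.
rewrite /count_seen -big_split/=; apply: eq_bigr => y _.
(* If [y + D] meets [x + P], it lies in the all-minus window, so nothing occurs at [y] beforehand;
   afterwards an occurrence at [y] makes [y - x] stabilise [P], forcing [y = x]. Otherwise [y + D]
   is untouched. *)
have [/exists_inP[u uP /exists_inP[v vD /eqP xyuv]]|far] :=
  boolP [exists u in P, [exists v in D, x + u == y + v]].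
  have yE t : y + t = x + (u - v + t) by rewrite !addrA xyuv addrK.
  have yD t : t \in D -> s (y + t) = false by move=> tD; rewrite yE sW// DW.
  have -> : seen D P y s = false.
    by apply/negbTE/forall_inPn; exists u0; rewrite // yD// u0P.
  congr nat_of_bool; apply/forall_inP/eqP => [yP|-> t tD].
    apply/eqP; rewrite -subr_eq0; apply/eqP/shiftP => t tP.
    have tD : t \in D by exact: (fintype.subsetP PD).
    have := yP t tD; rewrite ffunE yD// orbF tP => /eqP.
    by rewrite -(mem_shift x) addrA [x + (y - x)]addrC subrK.
  by rewrite ffunE mem_shift sW ?orbF//; exact: (fintype.subsetP subDW).
have -> : (y == x) = false.
  apply/negbTE; apply: contra far => /eqP ->.
  by apply/exists_inP; exists u0 => //; apply/exists_inP; exists u0.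
rewrite addn0; congr nat_of_bool; apply: eq_forallb_in => t tD.
rewrite ffunE; case: imsetP => //= -[u uP ytu].
by case/negP: far; apply/exists_inP; exists u => //; apply/exists_inP; exists t; rewrite // ytu.
Qed.

Lemma seen_isolated x s : seen W P x s =
  all_on (shift x P) s && seen W finset.set0 x (switch_off (shift x P) s).
Proof.
apply/idP/andP => [/forall_inP xW|[/forall_inP xP /seen_off_window xW]].
  split.
    apply/forall_inP => _ /imsetP[u uP ->].
    have uW : u \in W by exact: (fintype.subsetP (fintype.subset_trans PD subDW)).
    by rewrite (eqP (xW _ uW)).
  apply/forall_inP => u uW; rewrite ffunE mem_shift finset.in_set0 (eqP (xW _ uW)).
  by case: (u \in P).
apply/forall_inP => u uW; have := xW _ uW; rewrite ffunE mem_shift.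
by have [uP _|_ /= ->//] := boolP (u \in P); rewrite xP// mem_shift.
Qed.

Lemma seen_window x s : seen W P x s -> seen D P x s.
Proof.
move=> /forall_inP xW; apply/forall_inP => u uD.
by apply: xW; exact: (fintype.subsetP subDW).
Qed.

End pattern.

(** Stated for any injection preserving adjacency on [T], to cover both translations within a torus
    and transport between tori. *)
Lemma inner_edges_imset (R : realType) (d : nat) (p : \bar R) (rho : R)
    (m n : nat) (f : torus d m -> torus d n) (T : {set torus d m}) :
  injective f ->
  (forall u v, u \in T -> v \in T -> adj p rho (f u) (f v) = adj p rho u v) ->
  inner_edges p rho (f @: T)%SET = inner_edges p rho T.
Proof.
move=> finj fadj; rewrite /inner_edges.
rewrite -[RHS](card_imset _ (imset_inj finj)); congr #|pred_of_set _|.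
apply/setP => e; rewrite [LHS]inE; apply/andP/imsetP => [[/edgesP[x [y [xy ->]]]]|].
  rewrite finset.subUset !finset.sub1set => /andP[/imsetP[u uT xE] /imsetP[v vT yE]].
  exists [set u; v]%SET; last by rewrite imsetU1 imset_set1 xE yE.
  rewrite inE finset.subUset !finset.sub1set uT vT !andbT.
  by apply/edgesP; exists u, v; rewrite -fadj// -xE -yE.
move=> [e']; rewrite inE => /andP[/edgesP[x [y [xy ->]]]].
rewrite finset.subUset !finset.sub1set => /andP[xT yT] ->.
rewrite imsetU1 imset_set1 finset.subUset !finset.sub1set !imset_f//.
by split=> //; apply/edgesP; exists (f x), (f y); rewrite fadj.
Qed.

(** * Approximate Stein identity under the Ising measure *)

Section ising_pattern.
Variables (R : realType) (d : nat) (p : \bar R) (rho : R) (n : nat).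
Hypothesis n0 : (0 < n)%N.
Variables a b : R.
Hypothesis b0 : 0 <= b.
Local Notation V := (torus d n).
Variables D P W : {set V}.
Hypotheses (PD : P \subset D) (P0 : P != finset.set0).
Hypothesis DW : forall u v y, u \in P -> v \in D -> y \in D -> u - v + y \in W.
Hypothesis PW : forall u y, u \in P -> adj p rho u y -> y \in W.
Hypothesis shiftP : forall z, (forall u, u \in P -> z + u \in P) -> z = 0.
Variables (g : nat -> R) (M : R).
Hypothesis gM : forall j, `|g j| <= M.
Local Notation w := (@ising_weight R d p rho n a b).
Local Notation Z := (@partition_function R d p rho n a b).
Local Notation X := (count_seen D P).
Let v := valency d p rho n.
(** In the notation of the overview, [kappa] is [K eps], the cost bound per vertex, and [delta] is
    the exact factor for an isolated translate of [P]. *)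
Let kappa := expR (2 * a + 2 * b * v%:R).
Let delta := expR (2 * a) ^+ #|P| *
  expR (- 2 * b * (v%:R * #|P|%:R - 2 * (inner_edges p rho P)%:R)).

Let M0 : 0 <= M. Proof. exact: le_trans (gM 0). Qed.

Let w0 s : 0 <= w s. Proof. exact: expR_ge0. Qed.

Let PsubW : P \subset W.
Proof.
have /set0Pn[u uP] := P0; apply/fintype.subsetP => y yP.
have uD : u \in D by exact: (fintype.subsetP PD).
have yD : y \in D by exact: (fintype.subsetP PD).
by rewrite -(add0r y) -(subrr u) DW.
Qed.

Lemma weight_switch_on_shift x s : seen W finset.set0 x s ->
  w (switch_on (shift x P) s) = w s * delta.
Proof.
move=> xW; have sW := seen_off_window xW.
rewrite weight_switch_on_isolated//.
- have -> : inner_edges p rho (shift x P) = inner_edges p rho P.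
    by apply: inner_edges_imset => [|u u' _ _]; [exact: addrI|exact: adjDl].
  by rewrite card_imset//; exact: addrI.
- apply/forall_inP => _ /imsetP[u uP ->]; rewrite sW//.
  exact: (fintype.subsetP PsubW).
- move=> _ y /imsetP[u uP ->] uy.
  have yE : y = x + (y - x) by rewrite addrC subrK.
  rewrite yE sW//; apply: PW uP _.
  by rewrite -(adjDl _ _ x) -yE.
Qed.

Lemma sum_seen_window x :
  \sum_(s | seen W P x s) w s * g (X s) =
  delta * \sum_(s | seen W finset.set0 x s) w s * g (X s).+1.
Proof.
under eq_bigl do rewrite (seen_isolated PD P0 DW).
rewrite sum_all_on mulr_sumr; apply: eq_big => [s|s].
  apply/andb_idl => /seen_off_window sW.
  apply/forall_inP => _ /imsetP[u uP ->]; rewrite sW//.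
  exact: (fintype.subsetP PsubW).
move=> /andP[_ sW]; rewrite (count_switch_on PD P0 DW shiftP sW).
by rewrite weight_switch_on_shift// mulrAC mulrC mulrA.
Qed.

Lemma norm_sum_weight_le (B : pred (config d n)) (h : config d n -> nat) :
  `|\sum_(s | B s) w s * g (h s)| <= M * \sum_(s | B s) w s.
Proof.
rewrite mulr_sumr (le_trans (ler_norm_sum _ _ _))//; apply: ler_sum => s _.
by rewrite normrM ger0_norm// mulrC ler_wpM2r.
Qed.

(** A non-isolated occurrence has an extra plus at some [u] of [W] outside [P], hence [#|P|.+1]
    prescribed pluses; a union bound over [u] concludes. *)
Lemma sum_seen_not_window x :
  \sum_(s | seen D P x s && ~~ seen W P x s) w s <=
  #|W|%:R * (kappa ^+ #|P|.+1 * Z).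
Proof.
pose T u := shift x (u |: P).
apply: (@le_trans _ _ (\sum_(u in W :\: P) \sum_(s | all_on (T u) s) w s)).
  apply: ler_sum_union => // s /andP[/forall_inP sD /forall_inPn[u uW]].
  have sP t : t \in P -> s (x + t).
    by move=> tP; rewrite (eqP (sD _ _)) ?tP//; exact: (fintype.subsetP PD).
  have [/sP->//|uP] := boolP (u \in P); rewrite eqbF_neg negbK => su.
  exists u; first by rewrite inE uP.
  by apply/forall_inP => _ /imsetP[t tT ->]; case/setU1P: tT => [->//|/sP].
apply: (@le_trans _ _ (\sum_(u in W :\: P) kappa ^+ #|P|.+1 * Z)).
  apply: ler_sum => u; rewrite inE => /andP[uP _].
  have -> : #|P|.+1 = #|T u|.
    by rewrite card_imset ?cardsU1 ?uP//; exact: addrI.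
  exact: sum_weight_all_on_le.
rewrite sumr_const -[leLHS]mulr_natl ler_wpM2r//.
  by rewrite mulr_ge0 ?exprn_ge0 ?expR_ge0// ltW// partition_function_gt0.
by rewrite ler_nat subset_leq_card// subsetDl.
Qed.

Lemma sum_not_off_window x :
  \sum_(s | ~~ seen W finset.set0 x s) w s <= #|W|%:R * (kappa * Z).
Proof.
apply: (@le_trans _ _ (\sum_(u in W) \sum_(s | all_on [set x + u]%SET s) w s)).
  apply: ler_sum_union => // s /forall_inPn[u uW].
  rewrite finset.in_set0 eqbF_neg negbK => su; exists u => //.
  by apply/forall_inP => _ /finset.set1P ->.
rewrite mulr_natl -sumr_const; apply: ler_sum => u _.
by rewrite -[kappa]expr1 -(cards1 (x + u)); exact: sum_weight_all_on_le.
Qed.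

(** Both sums are split according to the window at [x]. The main parts cancel by [sum_seen_window],
    leaving the two discarded events. *)
Lemma seen_stein x :
  `|\sum_(s | seen D P x s) w s * g (X s) - delta * \sum_s w s * g (X s).+1|
  <= M * #|W|%:R * (kappa ^+ #|P|.+1 + delta * kappa) * Z.
Proof.
rewrite (bigID (seen W P x))/=.
have -> : \sum_(s | seen D P x s && seen W P x s) w s * g (X s) =
    delta * \sum_(s | seen W finset.set0 x s) w s * g (X s).+1.
  rewrite -sum_seen_window; apply: eq_bigl => s; apply/andb_idl.
  exact: seen_window.
rewrite [X in _ - delta * X](bigID (seen W finset.set0 x))/= mulrDr.
set S1 := delta * \sum_(s | seen W _ x s) _; set S2 := \sum_(s | _) _.
set S3 := \sum_(s | _) _.
rewrite opprD addrACA subrr add0r.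
have delta0 : 0 <= delta by rewrite mulr_ge0 ?exprn_ge0 ?expR_ge0.
apply: (le_trans (ler_normB _ _)); rewrite normrM (ger0_norm delta0).
have S2M : `|S2| <= M * (#|W|%:R * (kappa ^+ #|P|.+1 * Z)).
  apply: (le_trans (norm_sum_weight_le _ _)).
  by rewrite ler_wpM2l// sum_seen_not_window.
have S3M : `|S3| <= M * (#|W|%:R * (kappa * Z)).
  apply: (le_trans (norm_sum_weight_le _ (fun s => (X s).+1))).
  by rewrite ler_wpM2l// sum_not_off_window.
apply: (le_trans (lerD S2M (ler_wpM2l delta0 S3M))).
have regroup (W' K K' D' Z' : R) : M * (W' * (K' * Z')) +
  D' * (M * (W' * (K * Z'))) = M * W' * (K' + D' * K) * Z' by ring.
by rewrite regroup.
Qed.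

Lemma count_seen_stein :
  `|\sum_s w s * ((X s)%:R * g (X s)) -
    #|{: V}|%:R * delta * \sum_s w s * g (X s).+1|
  <= #|{: V}|%:R * (M * #|W|%:R * (kappa ^+ #|P|.+1 + delta * kappa) * Z).
Proof.
(* One factor [X] is expanded into its indicators, which reduces the claim to one local estimate per
   vertex. *)
have -> : \sum_s w s * ((X s)%:R * g (X s)) =
    \sum_x \sum_(s | seen D P x s) w s * g (X s).
  under [RHS]eq_bigr do rewrite big_mkcond/=.
  rewrite exchange_big/=; apply: eq_bigr => s _.
  rewrite mulrCA /count_seen natr_sum mulr_suml; apply: eq_bigr => x _.
  by case: (seen D P x s); rewrite ?mul1r ?mul0r.
rewrite -mulrA [X in _ - X]mulr_natl -sumr_const -sumrB.
rewrite (le_trans (ler_norm_sum _ _ _))// mulr_natl -sumr_const.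
by apply: ler_sum => x _; exact: seen_stein.
Qed.

End ising_pattern.

(** * Total variation bound *)

Lemma isingE (R : realType) (d : nat) (p : \bar R) (rho : R) (n : nat)
    (a b : R) (U : set (config d n)) :
  ising p rho n a b U =
  ((\sum_s ising_weight p rho a b s * (s \in U)%:R) /
    partition_function d p rho n a b)%:E.
Proof.
rewrite /ising esum_mkcond esum_fset; last 2 first.
- exact: finite_finset.
- move=> s _; case: ifP => // _.
  by rewrite lee_fin divr_ge0 ?expR_ge0// ltW// partition_function_gt0.
rewrite (_ : [set: config d n] = [set` enum {: config d n}]); last first.
  by apply/seteqP; split=> s //= _; rewrite mem_enum.
rewrite -fsbig_seq ?enum_uniq// big_enum/= mulr_suml -sumEFin.
apply: eq_bigr => s _; case: ifP => _; first by rewrite mulr1.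
by rewrite mulr0 mul0r.
Qed.

Lemma tv_dist_le (disp : measure_display) (T : measurableType disp)
    (R : realType) (mu nu : probability T R) (B : R) :
  (forall A, measurable A -> `|fine (mu A) - fine (nu A)| <= B) ->
  (tv_dist mu nu <= B%:E)%E.
Proof.
move=> muB; apply: ge_ereal_sup => _ [A mA <-].
have fin (P : probability T R) : P A \is a fin_num by exact: fin_num_measure.
by rewrite -(fineK (fin mu)) -(fineK (fin nu)) -EFinB abse_EFin lee_fin muB.
Qed.

(** Handles the finitely many sizes below [4 * m]. *)
Lemma tv_dist_le1 (disp : measure_display) (T : measurableType disp)
    (R : realType) (mu nu : probability T R) : (tv_dist mu nu <= 1%:E)%E.
Proof.
apply: tv_dist_le => A mA.
have le01 (P : probability T R) : 0 <= fine (P A) <= 1.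
  rewrite fine_ge0 ?measure_ge0//= -lee_fin fineK ?fin_num_measure//.
  exact: probability_le1.
have /andP[mu0 mu1] := le01 mu; have /andP[nu0 nu1] := le01 nu.
by rewrite ler_norml; apply/andP; split; lra.
Qed.

Lemma card_torus (d n : nat) : (0 < n)%N -> #|{: torus d n}| = (n ^ d)%N.
Proof. by move=> n0; rewrite card_ffun !card_ord prednK. Qed.

Section large_torus.
Variables (R : realType) (d : nat) (p : \bar R) (rho : R) (r m n : nat).
Variable eta : local_config d p rho r m.
Hypotheses (p1 : (1 <= p)%E) (rho0 : 0 < rho).
Hypotheses (admm : admissible rho r m) (mn : (4 * m <= n)%N).
Hypothesis k0 : (0 < #|positives eta|)%N.

Let m0 : (0 < m)%N.
Proof.
rewrite -(ltr0n R); apply: le_lt_trans admm.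
by rewrite !mulr_ge0// ltW.
Qed.

Let n0 : (0 < n)%N. Proof. by rewrite (leq_trans _ mn)// muln_gt0. Qed.

Let tr_inj := @transport_inj d _ _ m0 mn.

Let D : {set torus d n} := [set transport n y | y in gball p rho (0 : torus d m) r]%SET.
Let P : {set torus d n} := [set transport n y | y in positives eta]%SET.
(* Relatively to x, the union of the translates of D which meet x + P and of the
   neighbourhood of x + P. *)
Let W : {set torus d n} :=
  ([set t.1 - t.2.1 + t.2.2 | t in finset.setX P (finset.setX D D)] :|:
   [set t.1 + t.2 | t in finset.setX P [set y | adj p rho 0 y]])%SET.

Lemma positives_gball y : y \in positives eta -> y \in gball p rho 0 r.
Proof. by case/imsetP => z _ ->; exact: valP. Qed.

Lemma occursE x (s : config d n) : occurs eta x s = seen D P x s.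
Proof.
have etaE y : eta y = (transport n (val y) \in P).
  rewrite mem_imset//; apply/idP/imsetP => [etay|[z]].
    by exists y; rewrite ?inE.
  by rewrite inE => etaz /val_inj ->.
apply/forallP/forall_inP => [occ _ /imsetP[y y_r ->]|occ y].
  by rewrite (eqP (occ (exist _ y y_r))) etaE.
by rewrite etaE; apply: occ; rewrite imset_f//; exact: valP.
Qed.

Let PD : P \subset D.
Proof.
apply/fintype.subsetP => _ /imsetP[y yP ->].
by rewrite imset_f// positives_gball.
Qed.

Let cardP : #|P| = #|positives eta|.
Proof. by rewrite card_imset. Qed.

Let P0 : P != finset.set0.
Proof. by rewrite -card_gt0 cardP. Qed.

Let DW u v y : u \in P -> v \in D -> y \in D -> u - v + y \in W.
Proof.
move=> uP vD yD; rewrite inE; apply/orP; left.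
by apply/imsetP; exists (u, (v, y)); rewrite // !inE uP vD yD.
Qed.

Let PW u y : u \in P -> adj p rho u y -> y \in W.
Proof.
move=> uP uy; rewrite inE; apply/orP; right.
have yE : y = u + (y - u) by rewrite addrC subrK.
apply/imsetP; exists (u, y - u) => //.
by rewrite !inE uP/= -(adjDl _ _ u) addr0 -yE.
Qed.

Let shiftP z : (forall u, u \in P -> z + u \in P) -> z = 0.
Proof.
apply: (stable_shift0 m0 mn P0) => _ i /imsetP[u _ ->].
by rewrite minres_transport// minres_bound.
Qed.

(** It is computed on the reference torus, so the bound on [#|W|] is uniform in [n]. *)
Definition window_bound : nat :=
  (#|positives eta| * (#|gball p rho (0%R : torus d m) r| *
    #|gball p rho (0%R : torus d m) r|) +
   #|positives eta| * valency d p rho m)%N.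

Let valencyE : valency d p rho n = valency d p rho m.
Proof.
apply: valency_transport => //; apply: le_lt_trans admm.
by rewrite ler_peMr ?ler1n// mulr_ge0// ltW.
Qed.

Let cardW : (#|W| <= window_bound)%N.
Proof.
have cardD : #|D| = #|gball p rho (0 : torus d m) r| by rewrite card_imset.
apply: (leq_trans (leq_card_setU _ _)); apply: leq_add.
  by apply: (leq_trans (leq_imset_card _ _)); rewrite !cardsX cardP cardD.
by apply: (leq_trans (leq_imset_card _ _)); rewrite cardsX cardP -valencyE.
Qed.

Let perimeterE : (perimeter eta)%:~R =
  (valency d p rho n)%:R * #|P|%:R - 2 * (inner_edges p rho P)%:R :> R.
Proof.
rewrite valencyE cardP inner_edges_imset//; last first.
  by move=> u v uP vP; rewrite (adj_transport m0 mn p1 rho0 admm)// positives_gball.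
by rewrite /perimeter intrB !intrM.
Qed.

Lemma tv_dist_large_torus (a b c e lambda : R) : 0 <= b -> 0 < lambda ->
  n%:R ^+ d * expR (2 * a) ^+ #|positives eta| = c ->
  lambda = c * expR (- 2 * b * (perimeter eta)%:~R) ->
  e = expR (2 * a) * expR (2 * b * (valency d p rho m)%:R) ->
  (tv_dist (distribution (ising p rho n a b) (occurrences eta n))
     (poisson lambda) <=
   (expR lambda * window_bound%:R *
     (c * expR (2 * b * (valency d p rho m)%:R) ^+ #|positives eta| + lambda)
      * e)%:E)%E.
Proof.
move=> b0 l0 cE lE eE; apply: tv_dist_le => A _.
have [g gM gE] := poisson_stein A l0.
pose Z := partition_function d p rho n a b.
have Z0 : 0 < Z by exact: partition_function_gt0.
pose w := @ising_weight R d p rho n a b.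
have occE s : occurrences eta n s = count_seen D P s.
  by apply: eq_bigr => x _; rewrite occursE.
have -> : fine (distribution (ising p rho n a b) (occurrences eta n) A) =
    (\sum_s w s * (count_seen D P s \in A)%:R) / Z.
  rewrite /distribution /pushforward /= isingE /=; congr (_ / _).
  by apply: eq_bigr => s _; rewrite -occE; congr (_ * _).
have := count_seen_stein n0 a b0 PD P0 DW PW shiftP gM.
rewrite -perimeterE card_torus// natrX cardP valencyE.
set delta := expR (2 * a) ^+ _ * _; set kappa := expR (2 * a + _).
have deltaE : n%:R ^+ d * delta = lambda by rewrite mulrA cE lE.
have kappaE : kappa = e by rewrite eE -expRD.
rewrite -/Z deltaE kappaE => H.
(* The Stein equation is evaluated at [j = X(s)] and averaged over the Ising measure. *)
have -> : (\sum_s w s * (count_seen D P s \in A)%:R) / Z - fine (poisson lambda A) =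
    - (\sum_s w s * ((count_seen D P s)%:R * g (count_seen D P s)) -
      lambda * \sum_s w s * g (count_seen D P s).+1) / Z.
  rewrite -[X in _ / _ - X](mulfK (lt0r_neq0 Z0)) -mulrBl; congr (_ / _).
  rewrite mulr_sumr -sumrB -sumrN /Z /partition_function mulr_sumr -sumrB.
  apply: eq_bigr => s _; rewrite -/w [fine _ * _]mulrC -mulrBr -gE; ring.
rewrite normrM normrN normfV (gtr0_norm Z0) ler_pdivrMr//.
apply: (le_trans H).
(* One factor [e] is set aside as the rate; the number of vertices combines with [e ^+ k] and with
   [delta] into quantities free of [n]. *)
have regroup (N L W' D' e' E' Z' : R) : N * (L * W' * (e' * E' + D' * e') * Z') =
  W' * (L * (N * E' + N * D') * e' * Z') by ring.
rewrite exprS regroup deltaE.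
have -> : n%:R ^+ d * e ^+ #|positives eta| =
    c * expR (2 * b * (valency d p rho m)%:R) ^+ #|positives eta|.
  by rewrite eE exprMn mulrA cE.
have c0 : 0 <= c by rewrite -cE mulr_ge0 ?exprn_ge0 ?expR_ge0.
rewrite [expR lambda * window_bound%:R]mulrC -!mulrA.
rewrite ler_wpM2r//; last by rewrite ler_nat cardW.
rewrite !mulr_ge0 ?addr_ge0 ?mulr_ge0 ?exprn_ge0 ?expR_ge0 ?(ltW l0) ?(ltW Z0)//.
by rewrite eE mulr_ge0 ?expR_ge0.
Qed.

End large_torus.

Theorem theorem1p3 (R : realType) (d : nat) (p : \bar R) (rho : R)
    (r m : nat) (eta : local_config d p rho r m) (b c : R) (a : nat -> R) :
  let k := #|positives eta| in
  (1 <= d)%N -> (1 <= p)%E -> 0 < rho -> (0 < r)%N -> admissible rho r m ->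
  (1 <= k)%N -> 0 < c -> 0 < b ->
  (forall n, admissible rho r n ->
     expR (2 * a n) = c * n%:R `^ (- (d%:R / k%:R))) ->
  exists2 C : R, 0 < C & forall n, admissible rho r n ->
    (tv_dist (distribution (ising p rho n (a n) b) (occurrences eta n))
       (poisson (c ^+ k * expR (- 2 * b * (perimeter eta)%:~R)))
     <= (C * n%:R `^ (- (d%:R / k%:R)))%:E)%E.
Proof.
move=> k _ p1 rho0 _ admm k0 c0 b0 aE.
set lambda := c ^+ k * _; pose q : R := d%:R / k%:R; rewrite -/q in aE *.
have lambda0 : 0 < lambda by rewrite mulr_gt0 ?exprn_gt0 ?expR_gt0.
have adm_gt0 n : admissible rho r n -> 0 < n%:R :> R.
  by apply: le_lt_trans; rewrite !mulr_ge0// ltW.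
pose K := expR (2 * b * (valency d p rho m)%:R).
pose C1 := expR lambda * (window_bound eta)%:R * (c ^+ k * K ^+ k + lambda) * (c * K).
have C1_ge0 : 0 <= C1.
  rewrite /C1 !mulr_ge0 ?expR_ge0 ?(ltW c0)//.
  by rewrite addr_ge0 ?mulr_ge0 ?exprn_ge0 ?expR_ge0 ?(ltW c0) ?(ltW lambda0).
(* For [n < 4 * m], [C2] times the rate is at least 1, which bounds any total variation distance. *)
pose C2 : R := (4 * m)%:R `^ q.
have C2_gt0 : 0 < C2.
  by rewrite powR_gt0// natrM mulr_gt0// (adm_gt0 m).
exists (C1 + C2) => [|n admn]; first by rewrite ltr_wpDl.
have n0 := adm_gt0 n admn.
have s0 : 0 <= n%:R `^ (- q) :> R by exact: powR_ge0.
have [mn|nm] := leqP (4 * m) n; last first.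
  apply: (le_trans (tv_dist_le1 _ _)); rewrite lee_fin mulrDl -[leLHS]add0r.
  apply: lerD; first exact: mulr_ge0.
  rewrite powRN ler_pdivlMr ?powR_gt0// mul1r.
  by rewrite ge0_ler_powR ?nnegrE ?divr_ge0// ler_nat ltnW.
apply: (@le_trans _ _ (C1 * n%:R `^ (- q))%:E); last first.
  by rewrite lee_fin ler_wpM2r// lerDl ltW.
(* The scaling of the field makes the volume cancel exactly, so the Poisson parameter is the same
   for all [n]. *)
have nd : n%:R ^+ d * expR (2 * a n) ^+ k = c ^+ k.
  rewrite aE// exprMn mulrCA -[X in _ * (_ * X)]powR_mulrn// -powRrM mulNr.
  rewrite divfK ?pnatr_eq0 -?lt0n// powRN powR_mulrn ?ler0n//.
  by rewrite mulfV ?mulr1// expf_neq0// gt_eqF.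
have := tv_dist_large_torus p1 rho0 admm mn k0 (ltW b0) lambda0 nd erefl erefl.
move=> /le_trans; apply; rewrite lee_fin -/K -/k /C1 aE//.
by rewrite [c * _ * K]mulrAC !mulrA.
Qed.
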